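(* Let $r\ge n>1$ be integers, $s=\gcd(n,r)$, and suppose that the matrix $H_S$ is regular (invertible). Let $f$ denote the number of times a block $\begin{pmatrix}0&4\\-4&0\end{pmatrix}$ appears in the block diagonal form of $H_S$. Then $$f=\left\lfloor\frac{s-1}{2}\right\rfloor.$$
   Context: $N_r$ is the $r\times r$ matrix with all entries on and above the diagonal equal to $-1$ and zeros below the diagonal; $M_r=-N_r^t$. $H_S$ is the $nr\times nr$ integer skew-symmetric matrix consisting of $n\times n$ blocks of size $r\times r$ with diagonal blocks $-(M_r+N_r)$, all blocks above the diagonal equal to the identity $\mathbb I$ and all blocks below the diagonal equal to $-\mathbb I$. A block diagonal form of a skew-symmetric integer matrix $J$ of size $N$ and corank $c$ is a matrix $L^tJL=\operatorname{Diag}(D_1,\dots,D_k,0,\dots,0)$, with $L$ an integer matrix of determinant $\pm1$, $k=\tfrac12(N-c)$, and $D_i=\begin{pmatrix}0&h_i\\-h_i&0\end{pmatrix}$ nonzero; blocks are counted up to the sign of $h_i$. For $H_S$ all $|h_i|$ are in $\{1,2,4\}$ and their multiplicities are independent of the choice of $L$. *)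

(* Defs.v *)
From mathcomp Require Import all_boot all_order all_algebra.

Set Implicit Arguments.
Unset Strict Implicit.
Unset Printing Implicit Defensive.

Import Order.TTheory GRing.Theory Num.Theory.
Local Open Scope ring_scope.

Definition Nmx (r : nat) : 'M[int]_r :=
  \matrix_(i, j) (if (i <= j)%N then -1 else 0).

Definition Mmx (r : nat) : 'M[int]_r := - (Nmx r)^T.

(* The common size \sum_(i < n) r is n * r; this form comes from \mxblock. *)
Definition HS (n r : nat) : 'M[int]_(\sum_(i < n) r) :=
  \mxblock_(i < n, j < n)
    (if i == j then - (Mmx r + Nmx r)
     else if (i < j)%N then 1%:M
     else - 1%:M : 'M[int]_r).

Definition ratmx (N : nat) (J : 'M[int]_N) : 'M[rat]_N := map_mx intr J.

Definition corank (N : nat) (J : 'M[int]_N) : nat := (N - \rank (ratmx J))%N.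

Definition regular (N : nat) (J : 'M[int]_N) : bool := ratmx J \in unitmx.

(* Diag(D_1, .., D_k, 0, .., 0) for h = [:: h_1; ..; h_k]: with 0-based indices,
   the block of h`_m occupies rows and columns m.*2 and m.*2.+1, and h`_m = 0
   for m >= k. It contains all the blocks only if (size h).*2 <= N. *)
Definition block_diag (N : nat) (h : seq int) : 'M[int]_N :=
  \matrix_(i, j)
    (if ~~ odd i && (j == i.+1 :> nat) then h`_(i./2)
     else if ~~ odd j && (i == j.+1 :> nat) then - h`_(j./2)
     else 0).

Definition is_block_diag_form (N : nat) (J L : 'M[int]_N) (h : seq int) : Prop :=
  [/\ \det L = 1 \/ \det L = -1,
      (size h).*2 = (N - corank J)%N,
      all (fun x => x != 0) h
    & L^T *m J *m L = block_diag N h].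

(* Blocks are identified up to the sign of their entry h_i. *)
Definition block_count (m : int) (h : seq int) : nat :=
  count (fun x => `|x| == `|m|) h.

(* Main.v *)
Require Import Defs.
From mathcomp Require Import all_boot all_order all_algebra.
From mathcomp Require Import zify ring.

Set Implicit Arguments.
Unset Strict Implicit.
Unset Printing Implicit Defensive.

Import Order.TTheory GRing.Theory Num.Theory.
Local Open Scope ring_scope.

(* Write x, y for the negacyclic shifts of Z^n and Z^r acting on Z^n (x) Z^r, so
   that x^n = y^r = -1. The matrix with +1 on and above the diagonal and -1
   below is a(x) = 1 + x + ... + x^(n-1), which satisfies a(x) (1 - x) = 2, and
   H_S = a(x) + a(y) - 2. Hence H_S (1 - x) (1 - y) = 2 (1 - x y). With
   m = lcm(n, r), C = sum_(k < m) (x y)^k and G = (1 - x) (1 - y) C one gets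
   H_S G = 2 (1 - (-1)^(m/n + m/r)), so that H_S G = 4 when H_S is regular.
   Therefore every h_i divides 4, and the blocks with |h_i| = 4 are those which
   survive in 4 H_S^-1 = G modulo 2: the rank of G over F_2 is 2 f.

   Modulo 2, C is the sum of the elements of the subgroup generated by (1, 1) in
   Z/n x Z/r, whose quotient is Z/s. So G is the composite of the surjection
   F_2[Z/n x Z/r] -> F_2[Z/s], of (1 - z) (1 - z^-1) = z + z^-1, and of the
   transpose injection. The kernel of z + z^-1 consists of the functions on Z/s
   of period 2, and the rank is s - gcd(s, 2). *)

(** * Sums against indicators, and Kronecker products *)

Lemma sum_delta (R : pzSemiRingType) (I : finType) (c : I) (F : I -> R) :
  \sum_l (l == c)%:R * F l = F c.
Proof.
rewrite (bigD1 c) //= eqxx mul1r big1 ?addr0 // => l /negPf ->.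
by rewrite mul0r.
Qed.

Lemma sum_delta_mod (R : pzSemiRingType) (n x : nat) (n_gt0 : (0 < n)%N)
    (F : 'I_n -> R) :
  \sum_(l < n) (x == l %[mod n])%:R * F l = F (Ordinal (ltn_pmod x n_gt0)).
Proof.
rewrite -[RHS]sum_delta; apply: eq_bigr => l _.
by rewrite (modn_small (ltn_ord l)) eq_sym.
Qed.

(** The Kronecker product, indexed by the type that [\mxblock] produces, so that it compares with
    [HS] without any cast. *)
Definition tens (R : pzSemiRingType) (n r : nat) (A : 'M[R]_n) (B : 'M[R]_r) :
    'M[R]_(\sum_(i < n) r) :=
  \matrix_(p, q) (A (tagnat.sig1 p) (tagnat.sig1 q)
                  * B (tagnat.sig2 p) (tagnat.sig2 q)).

Lemma sum_sig (R : nmodType) (n r : nat) (F : 'I_n -> 'I_r -> R) :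
  \sum_(p < \sum_(i < n) r) F (tagnat.sig1 p) (tagnat.sig2 p)
  = \sum_i \sum_j F i j.
Proof.
rewrite sig_big_dep/= (reindex _ (@tagnat.sig_bij_on n (fun=> r)))/=.
by apply: eq_bigr => p _.
Qed.

Lemma eq_sig (n r : nat) (p q : 'I_(\sum_(i < n) r)) :
  (p == q) = (tagnat.sig1 p == tagnat.sig1 q)
             && (tagnat.sig2 p == tagnat.sig2 q :> 'I_r).
Proof.
apply/eqP/andP => [-> //|[/eqP e1 /eqP e2]].
rewrite -[p]tagnat.sig2K -[q]tagnat.sig2K; apply/val_inj/eqP.
by rewrite /= tagnat.eq_Rank e1 eqxx /= e2.
Qed.

Lemma tensM (R : comPzRingType) (n r : nat) (A C : 'M[R]_n) (B D : 'M[R]_r) :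
  tens A B * tens C D = tens (A * C) (B * D).
Proof.
apply/matrixP => p q; rewrite !mxE big_distrlr /=.
rewrite -(sum_sig (fun i j => _ * _ * (_ * _))); apply: eq_bigr => l _.
by rewrite !mxE mulrACA.
Qed.

Lemma tens1 (R : pzSemiRingType) (n r : nat) :
  tens (1 : 'M[R]_n) (1 : 'M[R]_r) = 1.
Proof.
apply/matrixP => p q; rewrite !mxE eq_sig.
by case: (_ == _); case: (_ == _); rewrite ?mulr0 ?mulr1.
Qed.

Lemma tensBl (R : pzRingType) (n r : nat) (A A' : 'M[R]_n) (B : 'M[R]_r) :
  tens (A - A') B = tens A B - tens A' B.
Proof. by apply/matrixP => p q; rewrite !mxE mulrBl. Qed.

Lemma tensBr (R : pzRingType) (n r : nat) (A : 'M[R]_n) (B B' : 'M[R]_r) :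
  tens A (B - B') = tens A B - tens A B'.
Proof. by apply/matrixP => p q; rewrite !mxE mulrBr. Qed.

Lemma tensX (R : comPzRingType) (n r k : nat) (A : 'M[R]_n) (B : 'M[R]_r) :
  tens A B ^+ k = tens (A ^+ k) (B ^+ k).
Proof. by elim: k => [|k IHk]; rewrite ?expr0 ?tens1 // !exprS IHk tensM. Qed.

Lemma map_tens (R S : pzSemiRingType) (f : {rmorphism R -> S}) (n r : nat)
    (A : 'M[R]_n) (B : 'M[R]_r) :
  map_mx f (tens A B) = tens (map_mx f A) (map_mx f B).
Proof. by apply/matrixP => p q; rewrite !mxE rmorphM. Qed.

(** * Negacyclic shifts and their relation to [HS] *)

Definition negacycle (n : nat) : 'M[int]_n :=
  \matrix_(i, j) ((j == i.+1 :> nat)%:R - (j + n == i.+1)%N%:R).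

Definition sgmx (n : nat) : 'M[int]_n :=
  \matrix_(i, j) (if (i <= j)%N then 1 else -1).

Lemma negacycleX (n k : nat) : (k <= n)%N ->
  negacycle n ^+ k
  = \matrix_(i, j) ((j == i + k :> nat)%N%:R - (j + n == i + k)%N%:R).
Proof.
elim: k => [_|k IHk kn].
  apply/matrixP => i j; rewrite !mxE addn0 -val_eqE /= eq_sym.
  by rewrite (_ : (j + n == i)%N = false) ?subr0 //; have := ltn_ord i; lia.
rewrite exprSr IHk 1?ltnW //; apply/matrixP => i j; rewrite !mxE.
(* Row [i] of the k-th power has one nonzero entry: 1 in column [i + k], or -1 in column [i + k - n]
   after wrapping around. *)
have [lt_ik|le_ik] := ltnP (i + k)%N n.
  rewrite (eq_bigr (fun l : 'I_n =>
    (l == Ordinal lt_ik)%:R * negacycle n l j)).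
    by rewrite sum_delta mxE /= addnS.
  move=> l _; rewrite !mxE (_ : (l + n == i + k)%N = false) ?subr0 //.
  lia.
have lt_ik : (i + k - n < n)%N by have := ltn_ord i; lia.
rewrite (eq_bigr (fun l : 'I_n =>
  (l == Ordinal lt_ik)%:R * - negacycle n l j)).
  rewrite sum_delta mxE /= opprB.
  rewrite (_ : (j + n == _.+1)%N = false); last by have := ltn_ord i; lia.
  rewrite (_ : (j == i + k.+1 :> nat)%N = false); last by have := ltn_ord j; lia.
  by rewrite !sub0r; congr (- (nat_of_bool _)%:R); lia.
move=> l _; rewrite !mxE mulrN -mulNr (_ : (l == i + k :> nat)%N = false).
  by rewrite sub0r -val_eqE /=; congr (- (nat_of_bool _)%:R * _); lia.
by have := ltn_ord l; lia.
Qed.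

Lemma negacycle_exp (n : nat) : negacycle n ^+ n = -1.
Proof.
rewrite negacycleX //; apply/matrixP => i j; rewrite !mxE eqn_add2r -val_eqE.
rewrite (_ : (j == i + n :> nat)%N = false) ?sub0r 1?eq_sym //.
by have := ltn_ord j; lia.
Qed.

Lemma sgmx_negacycle (n : nat) : sgmx n * (1 - negacycle n) = 2.
Proof.
apply/matrixP => i j; have n_gt0 : (0 < n)%N by have := ltn_ord i; lia.
rewrite mulrBr mulr1 !mxE.
(* Column [j] of [negacycle n] has one nonzero entry: 1 in row [j.-1], or -1 in the last row when
   [j] is 0. *)
have lt_pj : ((if j == 0 :> nat then n.-1 else j.-1) < n)%N.
  by have := ltn_ord j; case: ifP; lia.
rewrite (eq_bigr (fun l : 'I_n => (l == Ordinal lt_pj)%:R *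
   (sgmx n i l * (if j == 0 :> nat then -1 else 1)))).
  rewrite sum_delta !mxE /= -!val_eqE /=.
  by have := ltn_ord i; have := ltn_ord j; case: (altP (j =P 0%N :> nat));
     do !case: ifP => //; lia.
move=> l _; rewrite [negacycle _ _ _]mxE -val_eqE /= mulrCA; congr (_ * _).
have := ltn_ord l; have := ltn_ord j.
by case: (altP (j =P 0%N :> nat)) => /=; lia.
Qed.

(** Since [Mmx r] is minus the transpose of [Nmx r], a diagonal block of [HS] is [sgmx r - 1]; the
    two tensors give [sgmx r + 1] there, hence the correction by 2. *)
Lemma HS_tens (n r : nat) : HS n r = tens (sgmx n) 1 + tens 1 (sgmx r) - 2.
Proof.
apply/matrixP => p q; rewrite /HS !mxE eq_sig.
move: (tagnat.sig1 p) (tagnat.sig1 q) (tagnat.sig2 p : 'I_r)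
  (tagnat.sig2 q : 'I_r) => i j k l.
have [<-|ij] := eqVneq i j.
  rewrite /Mmx !mxE leqnn !mul1r /= -val_eqE /=.
  by case: (ltngtP k l) => //=; lia.
rewrite /= mulr0n mul0r !addr0 [(i <= j)%N]leq_eqVlt (negPf ij : (i == j :> nat) = false) /=.
by case: (i < j)%N; rewrite !mxE ?mul1r ?mulN1r.
Qed.

(** The product expands to 2(1 - y) + 2(1 - x) - 2(1 - x)(1 - y) = 2(1 - xy). *)
Lemma HS_diff (n r : nat) :
  HS n r * tens (1 - negacycle n) (1 - negacycle r)
  = (1 - tens (negacycle n) (negacycle r)) *+ 2.
Proof.
rewrite HS_tens mulrBl mulrDl mulr_natl !tensM !mul1r !sgmx_negacycle -tens1.
by apply/matrixP => p q; rewrite !mxE; ring.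
Qed.

(** * The integral matrix G, which is 4 times the inverse of [HS] in the regular case *)

Definition diag_sum (n r : nat) : 'M[int]_(\sum_(i < n) r) :=
  \sum_(k < lcmn n r) tens (negacycle n) (negacycle r) ^+ k.

Definition adj4 (n r : nat) : 'M[int]_(\sum_(i < n) r) :=
  tens (1 - negacycle n) (1 - negacycle r) * diag_sum n r.

(** The geometric sum telescopes to 1 - (xy)^m with m = lcm(n, r), and x^n = y^r = -1 evaluates the
    power. *)
Lemma HS_adj4 (n r : nat) :
  HS n r * adj4 n r
  = (1 - (-1) ^+ (lcmn n r %/ n + lcmn n r %/ r)) *+ 2.
Proof.
rewrite mulrA HS_diff mulrnAl -opprB mulNr -subrX1 opprB tensX.
rewrite -{1}(divnK (dvdn_lcml n r)) -{2}(divnK (dvdn_lcmr n r)).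
rewrite ![(_ * n)%N]mulnC ![(_ * r)%N]mulnC !exprM !negacycle_exp.
congr ((1 - _) *+ _); rewrite -[X in tens X _]signr_odd -[X in tens _ X]signr_odd.
rewrite -[RHS]signr_odd oddD.
by case: (odd _); case: (odd _); rewrite /= ?expr0 ?expr1 -?tens1;
   apply/matrixP => p q; rewrite !mxE; ring.
Qed.

(** Multiplying by a(x) a(y) turns the factor (1 - x)(1 - y) into 4, which is cancellable over the
    integers. *)
Lemma adj4_eq0 (n r : nat) : adj4 n r = 0 -> diag_sum n r = 0.
Proof.
move=> /(congr1 ( *%R (tens (sgmx n) (sgmx r)))).
rewrite mulr0 mulrA tensM !sgmx_negacycle.
have -> : tens (2 : 'M[int]_n) (2 : 'M[int]_r) = 4%:R.
  by rewrite -[4]/(1 *+ 4) -tens1; apply/matrixP => p q; rewrite !mxE; ring.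
rewrite mulr_natl => e.
apply/matrixP => p q; have /matrixP/(_ p q) := e.
by rewrite mulmxnE mxE => /eqP; rewrite mulrn_eq0 => /eqP ->; rewrite ?mxE.
Qed.

Lemma regular_mul_eq0 (N : nat) (J G : 'M[int]_N) :
  regular J -> J * G = 0 -> G = 0.
Proof.
move=> uJ JG; have e : ratmx G = 0.
  rewrite -[LHS](mulKmx uJ) /ratmx -(map_mxM intr) [J *m G]JG.
  by rewrite (map_mx0 intr) mulmx0.
apply/matrixP => p q; have /matrixP/(_ p q) := e.
by rewrite !mxE => /eqP; rewrite intr_eq0 => /eqP.
Qed.

(** * Simultaneous congruences modulo n and r *)

Lemma eqn_mod_lcm (a b n r : nat) :
  (a == b %[mod lcmn n r]) = (a == b %[mod n]) && (a == b %[mod r]).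
Proof.
wlog le_ab : a b / (a <= b)%N.
  move=> W; case: (leqP a b) => [/W //|/ltnW/W].
  by rewrite ![(b %% _)%N == _]eq_sym.
by rewrite ![(a %% _)%N == _]eq_sym !eqn_mod_dvd // dvdn_lcm.
Qed.

Lemma modn_crt (n r x y : nat) : (0 < r)%N ->
  x = y %[mod gcdn n r] ->
  exists2 k : nat, k = x %[mod n] & k = y %[mod r].
Proof.
move=> r_gt0 exy; have [u _ dvd_u] := Bezoutl n r_gt0.
have dvd_w : (gcdn n r %| x + r.-1 * y)%N.
  rewrite /dvdn -modnDml exy modnDml -mulSn prednK //.
  by apply: dvdn_mulr; apply: dvdn_gcdr.
(* [r.-1 * y] stands for -y modulo r, so x - y is w gcd(n, r); as u n is -gcd(n, r) modulo r, adding
   w u n to x gives y. *)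
case/dvdnP: dvd_w => w ew; exists (w * u * n + x)%N.
  by rewrite modnMDl.
apply/eqP; rewrite -(eqn_modDr (r.-1 * y)) -addnA ew -mulSn prednK //.
rewrite modnMr -mulnA -mulnDr addnC [gcdn n r]gcdnC.
exact: dvdn_mull.
Qed.

Lemma modn_dvd_eq (d m a b : nat) :
  (d %| m)%N -> a = b %[mod m] -> a = b %[mod d].
Proof. by move=> dm e; rewrite -(modn_dvdm a dm) e modn_dvdm. Qed.

(** The sum counts the solutions k of two congruences over one period lcm(n, r): by the Chinese
    remainder theorem there is exactly one if they are compatible modulo the gcd, and none
    otherwise. *)
Lemma sum_crt (R : pzSemiRingType) (n r a b c d : nat) : (0 < n)%N -> (0 < r)%N ->
  \sum_(k < lcmn n r) ((a + k == b %[mod n])%N && (c + k == d %[mod r])%N)%:R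
  = (a + d == b + c %[mod gcdn n r])%N%:R :> R.
Proof.
move=> n_gt0 r_gt0.
have sn := dvdn_gcdl n r; have sr := dvdn_gcdr n r.
case: eqP => [e|ne]; last first.
  apply: big1 => k _; case: andP => // -[/eqP e1 /eqP e2]; case: ne.
  rewrite -modnDmr -(modn_dvd_eq sr e2) modnDmr [(c + k)%N]addnC.
  by rewrite addnA -modnDml (modn_dvd_eq sn e1) modnDml.
(* The residues are b - a and d - c, with [n.-1] and [r.-1] in the role of -1. *)
have [k0 k0n k0r] : exists2 k : nat, k = b + a * n.-1 %[mod n]
    & k = d + c * r.-1 %[mod r].
  apply: modn_crt => //; apply/eqP; rewrite -(eqn_modDl (a + c)).
  have -> : (a + c + (b + a * n.-1) = a * n + (b + c))%N.
    by rewrite -[in RHS](prednK n_gt0) mulnS; lia.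
  have -> : (a + c + (d + c * r.-1) = c * r + (a + d))%N.
    by rewrite -[in RHS](prednK r_gt0) mulnS; lia.
  rewrite -modnDml (eqP (dvdn_mull a sn)) -[X in _ == X]modnDml.
  by rewrite (eqP (dvdn_mull c sr)) !add0n e.
have lcm_gt0 : (0 < lcmn n r)%N by rewrite lcmn_gt0 n_gt0.
rewrite -[RHS](@sum_delta_mod _ _ k0 lcm_gt0 (fun=> 1)); apply: eq_bigr => k _.
rewrite mulr1 eqn_mod_lcm; congr (nat_of_bool (_ && _))%:R.
  rewrite -(eqn_modDl a k0) -(modnDmr a k0 n) k0n modnDmr.
  by rewrite addnCA -mulnS prednK // [(b + _)%N]addnC modnMDl eq_sym.
rewrite -(eqn_modDl c k0) -(modnDmr c k0 r) k0r modnDmr.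
by rewrite addnCA -mulnS prednK // [(d + _)%N]addnC modnMDl eq_sym.
Qed.

(** * Reduction modulo 2 and factorization through Z/s *)

Lemma oppF2 (x : 'F_2) : - x = x.
Proof. by rewrite oppr_pchar2 // pchar_Fp. Qed.

Definition cshift (n k : nat) : 'M['F_2]_n :=
  \matrix_(i, j) (i + k == j %[mod n])%N%:R.

Lemma cshift0 (n : nat) : cshift n 0 = 1.
Proof.
by apply/matrixP => i j; rewrite !mxE addn0 !modn_small.
Qed.

Lemma cshift_mod (n k : nat) : cshift n (k %% n) = cshift n k.
Proof. by apply/matrixP => i j; rewrite !mxE modnDmr. Qed.

Lemma cshiftD (n k l : nat) : cshift n (k + l) = cshift n k * cshift n l.
Proof.
apply/matrixP => i j; have n_gt0 : (0 < n)%N by apply: leq_trans (ltn_ord i).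
rewrite !mxE; under eq_bigr => h _ do rewrite mxE.
by rewrite (sum_delta_mod _ n_gt0) mxE /= modnDml addnA.
Qed.

Lemma cshiftX (n k : nat) : cshift n 1 ^+ k = cshift n k.
Proof.
by elim: k => [|k IHk]; rewrite ?cshift0 // exprSr IHk -cshiftD addn1.
Qed.

(** The sign of the wrap-around entry disappears modulo 2. *)
Lemma negacycle_mod2 (n : nat) :
  map_mx (intr : int -> 'F_2) (negacycle n) = cshift n 1.
Proof.
apply/matrixP => i j; rewrite !mxE rmorphB !rmorph_nat oppF2 -natrD.
rewrite [(j %% n)%N]modn_small // addn1; congr _%:R.
have [lt_in|le_ni] := ltnP i.+1 n; first by rewrite modn_small //; lia.
have -> : i.+1 = n by have := ltn_ord i; lia.
by rewrite modnn; have := ltn_ord j; lia.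
Qed.

Lemma map_mx_exp (R S : pzSemiRingType) (f : {rmorphism R -> S}) (n k : nat)
    (A : 'M[R]_n) :
  map_mx f (A ^+ k) = map_mx f A ^+ k.
Proof.
elim: k => [|k IHk]; first by rewrite !expr0 [LHS]map_mx1.
by rewrite !exprS -IHk [LHS]map_mxM.
Qed.

Lemma tensE (R : comPzRingType) (n r : nat) (A : 'M[R]_n) (B : 'M[R]_r) :
  tens A B = tens A 1 * tens 1 B.
Proof. by rewrite tensM mulr1 mul1r. Qed.

(* The matrix of Z/n x Z/r -> Z/s, (a, b) |-> a - b, where -b is written
   s.-1 * b to stay within nat. *)
Definition antidiag (s n r : nat) : 'M['F_2]_(\sum_(i < n) r, s) :=
  \matrix_(p, i)
    (tagnat.sig1 p + s.-1 * tagnat.sig2 p == i %[mod s])%N%:R.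

(** Translation by (k, l) descends to translation by k - l on Z/s; divisibility of n and r by s
    makes the map to Z/s well defined. *)
Lemma tens_antidiag (s n r k l : nat) : (s %| n)%N -> (s %| r)%N ->
  tens (cshift n k) (cshift r l) *m antidiag s n r
  = antidiag s n r *m cshift s (k + s.-1 * l).
Proof.
move=> sn sr; apply/matrixP => p i.
have s_gt0 : (0 < s)%N by apply: leq_trans (ltn_ord i).
have n_gt0 : (0 < n)%N by apply: leq_trans (ltn_ord (tagnat.sig1 p)).
have r_gt0 : (0 < r)%N.
  by apply: leq_trans (ltn_ord (tagnat.sig2 p : 'I_r)).
rewrite !mxE; under eq_bigr => q _ do rewrite !mxE -mulrA.
rewrite (sum_sig (fun a b => (_ == a %[mod n])%N%:R *
  ((_ == b %[mod r])%N%:R * (a + s.-1 * b == i %[mod s])%N%:R))).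
under eq_bigr => a _ do rewrite -mulr_sumr (sum_delta_mod _ r_gt0) /=.
rewrite (sum_delta_mod _ n_gt0) /=.
under [RHS]eq_bigr => q _ do rewrite !mxE.
rewrite (sum_delta_mod _ s_gt0) /=.
rewrite [in RHS]modnDml -addnACA -mulnDr; congr (nat_of_bool (_ == _))%:R.
by rewrite -modnDm -[in LHS]modnMmr !modn_dvdm // modnMmr modnDm.
Qed.

(** By [sum_crt], the entry at (p, q) is 1 exactly when p and q have the same image in Z/s, which is
    also what the product with the transpose records. *)
Lemma map_diag_sum (n r : nat) : (0 < n)%N -> (0 < r)%N ->
  map_mx (intr : int -> 'F_2) (diag_sum n r)
  = antidiag (gcdn n r) n r *m (antidiag (gcdn n r) n r)^T.
Proof.
move=> n_gt0 r_gt0; have s_gt0 : (0 < gcdn n r)%N by rewrite gcdn_gt0 n_gt0.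
apply/matrixP => p q; rewrite /diag_sum (map_mx_sum intr) summxE.
under eq_bigr => k _.
  rewrite tensX map_tens /= !(map_mx_exp intr) !negacycle_mod2 !cshiftX.
  rewrite !mxE -natrM mulnb.
  over.
rewrite sum_crt // !mxE; under [RHS]eq_bigr => i _ do rewrite !mxE.
rewrite (sum_delta_mod _ s_gt0) /= modn_mod.
set x := tagnat.sig1 p; set y := tagnat.sig2 p.
set z := tagnat.sig1 q; set t := tagnat.sig2 q.
(* Adding y + t to both sides completes the multiples of s - 1 to multiples of s, which vanish. *)
rewrite -[in RHS](eqn_modDr (y + t)) eq_sym.
have mod_s (a b : nat) : (b + gcdn n r * a = b %[mod gcdn n r])%N.
  by rewrite addnC mulnC modnMDl.
have e (a b c : nat) :
    (a + (gcdn n r).-1 * b + (b + c) = a + c + gcdn n r * b)%N.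
  by rewrite -[in RHS](prednK s_gt0) mulSn; lia.
by rewrite e [(y + t)%N]addnC e !mod_s.
Qed.

Lemma map_adj4 (n r : nat) (s := gcdn n r) : (0 < n)%N -> (0 < r)%N ->
  map_mx (intr : int -> 'F_2) (adj4 n r)
  = antidiag s n r *m (cshift s 1 + cshift s s.-1) *m (antidiag s n r)^T.
Proof.
move=> n_gt0 r_gt0; have s_gt0 : (0 < s)%N by rewrite gcdn_gt0 n_gt0.
have sn : (s %| n)%N := dvdn_gcdl n r; have sr : (s %| r)%N := dvdn_gcdr n r.
have eY : tens 1 (1 - cshift r 1) *m antidiag s n r
    = antidiag s n r *m (1 - cshift s s.-1).
  rewrite tensBr tens1 mulmxBl mulmxBr mul1mx mulmx1 -{1}cshift0.
  by rewrite tens_antidiag // muln1.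
have eX : tens (1 - cshift n 1) 1 *m antidiag s n r
    = antidiag s n r *m (1 - cshift s 1).
  rewrite tensBl tens1 mulmxBl mulmxBr mul1mx mulmx1 -{1}cshift0.
  by rewrite tens_antidiag // muln0.
(* With z = [cshift s 1] and z^-1 = [cshift s s.-1], this is 2 - z - z^-1 read modulo 2. *)
have e : (1 - cshift s 1) *m (1 - cshift s s.-1) = cshift s 1 + cshift s s.-1.
  rewrite -[LHS]/(_ * _) mulrBl mul1r mulrBr mulr1 -cshiftD add1n prednK //.
  rewrite -[cshift s s]cshift_mod modnn cshift0.
  apply/matrixP => i j; rewrite !mxE !oppF2 addrC addrA.
  by rewrite -[X in X + _]addrA addrr_pchar2 ?pchar_Fp // addr0.
rewrite [LHS]map_mxM map_diag_sum // mulmxA; congr (_ *m _).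
rewrite map_tens !(map_mxB intr) !(map_mx1 intr) !negacycle_mod2.
by rewrite tensE -[_ * _]/(_ *m _) -mulmxA eY mulmxA eX -mulmxA e.
Qed.

(** * The rank of G over F_2 *)

Lemma rank_cshift (s : nat) : (0 < s)%N ->
  \rank (cshift s 1 + cshift s s.-1)%R = (s - gcdn s 2)%N.
Proof.
move=> s_gt0; set Q := cshift s 1 + _; set g := gcdn s 2.
have g_gt0 : (0 < g)%N by rewrite gcdn_gt0 orbT.
have gs : (g %| s)%N := dvdn_gcdl s 2.
have le_gs : (g <= s)%N := dvdn_leq s_gt0 gs.
(* Reading the index modulo s lets periodicity be stated on all of [nat]. *)
pose at_ (u : 'rV['F_2]_s) x := u 0 (Ordinal (ltn_pmod x s_gt0)).
have at_eq u x y : x = y %[mod s] -> at_ u x = at_ u y.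
  by move=> exy; congr (u _ _); apply: val_inj.
have mulQ u x : (u *m Q) 0 (Ordinal (ltn_pmod x s_gt0))
    = at_ u (x + s.-1)%N + at_ u x.+1.
  rewrite mulmxDr !mxE; congr (_ + _).
    rewrite -[RHS]sum_delta; apply: eq_bigr => i _; rewrite mxE mulrC.
    congr ((nat_of_bool _)%:R * _); rewrite modn_mod -(eqn_modDr s.-1).
    by rewrite -addnA add1n prednK // modnDr modn_small // -val_eqE /=.
  rewrite -[RHS]sum_delta; apply: eq_bigr => i _; rewrite mxE mulrC.
  congr ((nat_of_bool _)%:R * _); rewrite modn_mod -(eqn_modDr 1).
  by rewrite -addnA addn1 prednK // modnDr modn_small // addn1 -val_eqE.
(* The rows are the indicators of the residue classes modulo g, a basis of the functions of period
   g. *)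
pose Phi : 'M['F_2]_(g, s) := \matrix_(k, i) (i == k %[mod g])%N%:R.
have kerQ : (kermx Q :=: Phi)%MS.
  apply/eqmxP/andP; split.
    apply/rV_subP => u /sub_kermxP uQ.
    have at2 x : at_ u (x + 2)%N = at_ u x.
      have := mulQ u x.+1; rewrite uQ mxE addSnnS prednK //.
      rewrite [at_ u (x + s)%N](@at_eq u _ x) ?modnDr // addn2 => /esym/eqP.
      by rewrite addrC addr_eq0 oppF2 => /eqP.
    have at2M x a : at_ u (x + a * 2)%N = at_ u x.
      by elim: a => [|a IHa]; rewrite ?addn0 // mulSnr addnA at2.
    have atg x : at_ u (x + g)%N = at_ u x.
      (* g + 2a is a multiple of s, so periods 2 and s yield period g. *)
      have [a _ /dvdnP [b eb]] := Bezoutl 2 s_gt0.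
      rewrite -(at2M _ a) -addnA eb; apply: at_eq.
      by rewrite addnC modnMDl.
    have atgM x a : at_ u (x + a * g)%N = at_ u x.
      by elim: a => [|a IHa]; rewrite ?addn0 // mulSnr addnA atg.
    apply/submxP; exists (\row_(k < g) at_ u k); apply/rowP => i.
    rewrite mxE; under eq_bigr => k _ do rewrite !mxE mulrC.
    rewrite (sum_delta_mod _ g_gt0) /= -(atgM _ (i %/ g)%N) addnC -divn_eq.
    by congr (u _ _); apply: val_inj; rewrite /= modn_small.
  rewrite sub_kermx; apply/eqP/row_matrixP => k; rewrite row_mul row0.
  apply/rowP => j; rewrite [RHS]mxE.
  have -> : j = Ordinal (ltn_pmod j s_gt0).
    by apply: val_inj; rewrite /= modn_small.
  rewrite mulQ /at_ !mxE /= !modn_dvdm //; apply/eqP.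
  rewrite addr_eq0 oppF2; apply/eqP; congr (nat_of_bool (_ == _))%:R.
  apply/eqP; rewrite -(eqn_modDr 2) (_ : j + s.-1 + 2 = s + j.+1)%N; last by lia.
  rewrite -modnDml (eqP gs) add0n -modnDmr.
  by rewrite (eqP (dvdn_gcdr s 2)) addn0.
have rPhi : \rank Phi = g.
  apply/eqP/row_freeP.
  exists (\matrix_(i < s, k < g) (i == widen_ord le_gs k)%:R).
  apply/matrixP => k l; rewrite !mxE.
  under eq_bigr => i _ do rewrite !mxE mulrC.
  by rewrite sum_delta /= !modn_small // eq_sym.
have := rank_leq_row Q; have := mxrank_ker Q; rewrite kerQ rPhi; lia.
Qed.

Lemma rank_adj4 (n r : nat) (s := gcdn n r) : (0 < n)%N -> (0 < r)%N ->
  \rank (map_mx (intr : int -> 'F_2) (adj4 n r)) = (s - gcdn s 2)%N.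
Proof.
move=> n_gt0 r_gt0; have s_gt0 : (0 < s)%N by rewrite gcdn_gt0 n_gt0.
rewrite map_adj4 // -/s -rank_cshift //.
set Q := cshift s 1 + _; set P := antidiag s n r.
(* The section i -> (i, 0) of the map to Z/s: a left inverse of P, so multiplying by P and its
   transpose preserves the rank. *)
pose W : 'M['F_2]_(s, \sum_(i < n) r) := \matrix_(i, p)
  ((tagnat.sig1 p == i :> nat)%:R * (tagnat.sig2 p == 0 :> nat)%:R).
have WP : W *m P = 1%:M.
  have le_sn : (s <= n)%N := dvdn_leq n_gt0 (dvdn_gcdl n r).
  apply/matrixP => i j; rewrite !mxE.
  under eq_bigr => p _ do rewrite !mxE -mulrA.
  rewrite (sum_sig (fun a b => (a == widen_ord le_sn i)%:R *
    ((b == Ordinal r_gt0)%:R * (a + s.-1 * b == j %[mod s])%N%:R))).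
  under eq_bigr => a _ do rewrite -mulr_sumr sum_delta /=.
  by rewrite sum_delta /= muln0 addn0 !modn_small.
apply/eqP; rewrite eqn_leq; apply/andP; split.
  by apply: leq_trans (mxrankM_maxl _ _) (mxrankM_maxr _ _).
rewrite -[X in (\rank X <= _)%N]mulmx1 -trmx1 -WP trmx_mul mulmxA.
rewrite -[X in (\rank (X *m _ *m _) <= _)%N]mul1mx -WP.
rewrite -!mulmxA; apply: leq_trans (mxrankM_maxr _ _) _.
by rewrite !mulmxA; apply: mxrankM_maxl.
Qed.

(** * Counting blocks by a rank over F_2 *)

Lemma rank_diag_mx (F : fieldType) (N : nat) (d : 'rV[F]_N) :
  \rank (diag_mx d) = (\sum_i (d 0%R i != 0%R))%N.
Proof.
elim: N d => [|N IHN] d; first by rewrite big_ord0 thinmx0 mxrank0.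
have [u [v ->]] : exists (u : 'rV_1) (v : 'rV_N), d = row_mx u v.
  by exists (lsubmx (d : 'rV_(1 + N))), (rsubmx (d : 'rV_(1 + N)));
     rewrite hsubmxK.
rewrite -[LHS]/(\rank (diag_mx (row_mx u v))) diag_mx_row.
rewrite rank_diag_block_mx IHN.
rewrite (@big_split_ord _ _ _ 1 N) big_ord1; congr (_ + _)%N.
  transitivity (u 0 0 != 0 : nat); last by rewrite -(row_mxEl u v).
  rewrite (_ : diag_mx u = u) ?rank_rV; last first.
    by apply/matrixP => i j; rewrite !ord1 !mxE.
  congr (nat_of_bool (~~ _)); apply/eqP/eqP => [->|u0]; first by rewrite mxE.
  by apply/rowP => i; rewrite ord1 u0 mxE.
by apply: eq_bigr => i _; rewrite -(row_mxEr u v).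
Qed.

Lemma rank_map_mul_le (R : pzSemiRingType) (F : fieldType) (f : {rmorphism R -> F})
    (m n p q : nat) (U : 'M[R]_(m, n)) (A : 'M[R]_(n, p)) (V : 'M[R]_(p, q)) :
  (\rank (map_mx f (U *m A *m V)) <= \rank (map_mx f A))%N.
Proof.
rewrite !map_mxM; apply: leq_trans (mxrankM_maxl _ _) _; exact: mxrankM_maxr.
Qed.

Lemma sum_half (f : nat -> nat) (k : nat) :
  (\sum_(i < k.*2) f i./2 = (\sum_(i < k) f i).*2)%N.
Proof.
elim: k => [|k IHk]; first by rewrite !big_ord0.
rewrite doubleS !big_ord_recr /= IHk uphalf_double doubleK.
by rewrite doubleD -addnA addnn.
Qed.

Lemma count_sum (T : Type) (x0 : T) (p : pred T) (s : seq T) :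
  count p s = (\sum_(i < size s) p (nth x0 s i))%N.
Proof. by rewrite -sum1_count big_mkcond (big_nth x0) big_mkord. Qed.

(** The involution exchanging the two indices of each 2 x 2 block; it reduces a block diagonal form
    to a diagonal matrix. *)
Definition partner (i : nat) : nat := if odd i then i.-1 else i.+1.

Definition partner_mx (N : nat) : 'M[int]_N :=
  \matrix_(i, j) (j == partner i :> nat)%:R.

Lemma partnerK (i : nat) : partner (partner i) = i.
Proof. by rewrite /partner; case: (boolP (odd i)); case: ifP; lia. Qed.

Lemma partner_mxK (N : nat) : ~~ odd N -> partner_mx N *m partner_mx N = 1%:M.
Proof.
move=> eN; apply/matrixP => i j; rewrite !mxE.
have lt_i : (partner i < N)%N.
  by have := ltn_ord i; rewrite /partner; case: ifP; lia.
rewrite (eq_bigr (fun l => (l == Ordinal lt_i)%:R * partner_mx N l j)).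
  by rewrite sum_delta mxE /= partnerK eq_sym.
by move=> l _; rewrite mxE.
Qed.

Lemma block_diagE (N : nat) (h : seq int) :
  block_diag N h
  = diag_mx (\row_i ((-1) ^+ odd i * h`_(i./2))) *m partner_mx N.
Proof.
apply/matrixP => i j; rewrite mul_diag_mx !mxE /partner.
case: (boolP (odd i)) => oi /=.
  rewrite expr1 mulN1r.
  have -> : ((~~ odd j) && (i == j.+1 :> nat))%N = (j == i.-1 :> nat) by lia.
  case: eqP => [->|]; rewrite ?mulr0 ?mulr1 //.
  by congr (- h`_ _); lia.
rewrite expr0 mul1r; case: eqP => _; rewrite ?mulr1 // mulr0.
by rewrite (_ : (~~ odd j) && _ = false) //; lia.
Qed.

(** Among the divisors of 4 only 1 and -1 are odd, so the cofactor y is odd exactly when x is 4 or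
    -4. *)
Lemma divisor4_F2 (x y : int) : x * y = 4 ->
  (y%:~R != 0 :> 'F_2) = (`|x| == `|4 : int|).
Proof.
move=> xy; rewrite -(dvdz_pcharf (pchar_Fp (isT : prime 2))) dvdzE /=.
have : (absz x * absz y = 4)%N by rewrite -abszM xy.
rewrite (_ : (`|x| == _) = (absz x == 4)%N); last by lia.
move: (absz x) (absz y) => a b ab.
have : (b <= 4)%N by apply: dvdn_leq; rewrite // -ab dvdn_mull.
by case: b ab => [|[|[|[|[|b]]]]] //= ab _; lia.
Qed.

(** Up to unimodular factors, G becomes a diagonal matrix Y with entries 4 / e_i, where e_i is
    [h_(i/2)] up to sign. The rank modulo 2 counts the odd entries, two for each block with |h| =
    4. *)
Lemma block_count_rank (N : nat) (J L G : 'M[int]_N) (h : seq int) :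
  regular J -> is_block_diag_form J L h -> J *m G = 4%:M ->
  (block_count 4 h).*2 = \rank (map_mx (intr : int -> 'F_2) G).
Proof.
move=> uJ [detL + _ LJL] JG; rewrite /corank mxrank_unit // subnn subn0 => sz.
have uL : L \in unitmx by rewrite unitmxE; case: detL => ->.
have uLt : L^T \in unitmx by rewrite unitmx_tr.
have eN : ~~ odd N by rewrite -sz odd_double.
pose Y := partner_mx N *m invmx L *m G *m invmx L^T.
have G_Y : G = L *m partner_mx N *m Y *m L^T.
  rewrite /Y -!mulmxA mulVmx // mulmx1 [partner_mx N *m (partner_mx N *m _)]mulmxA.
  by rewrite partner_mxK // mul1mx mulKVmx.
pose e i : int := (-1) ^+ odd i * h`_(i./2).
have eY (i j : 'I_N) : e i * Y i j = (i == j)%:R * 4.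
  have : diag_mx (\row_i e i) *m Y = 4%:M.
    rewrite /Y !mulmxA -block_diagE -LJL mulmxK // -[_ *m J *m G]mulmxA JG.
    by rewrite mul_mx_scalar -scalemxAl mulmxV // scalemx1.
  by move/matrixP/(_ i j); rewrite mul_diag_mx !mxE mulr_natl.
have Y_G : Y = partner_mx N *m invmx L *m G *m invmx L^T by [].
clearbody Y.
have e_neq0 (i : 'I_N) : e i != 0.
  by apply/eqP => e0; have := eY i i; rewrite e0 mul0r eqxx.
have Y_diag : Y = diag_mx (\row_i Y i i).
  apply/matrixP => i j; rewrite !mxE; case: eqP => [->|/eqP ij] //.
  have /eqP := eY i j; rewrite (negPf ij) mul0r mulf_eq0 (negPf (e_neq0 i)) /=.
  by move/eqP.
transitivity (\rank (map_mx (intr : int -> 'F_2) Y)); last first.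
  apply/eqP; rewrite eqn_leq; apply/andP; split.
    by rewrite Y_G; apply: (rank_map_mul_le intr).
  by rewrite [in X in (X <= _)%N]G_Y; apply: (rank_map_mul_le intr).
rewrite Y_diag map_diag_mx rank_diag_mx.
under eq_bigr => i _.
  rewrite !mxE (@divisor4_F2 (e i)); last by rewrite eY eqxx mul1r.
  rewrite /e normrMsign.
  over.
rewrite -(big_mkord xpredT (fun i => nat_of_bool (`|h`_(i./2)| == `|4 : int|))).
rewrite -sz big_mkord (sum_half (fun i => nat_of_bool (`|h`_i| == `|4 : int|))).
by rewrite -(count_sum 0 (fun x : int => `|x| == `|4 : int|)).
Qed.

Theorem proposition4p4 (n r : nat) (hn : (1 < n)%N) (hr : (n <= r)%N)
    (hreg : regular (HS n r))
    (L : 'M[int]_(\sum_(i < n) r)) (h : seq int)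
    (hL : is_block_diag_form (HS n r) L h) :
  let s := gcdn n r in
  block_count 4 h = ((s - 1) %/ 2)%N.
Proof.
move=> s; have n_gt0 : (0 < n)%N by apply: ltnW.
have r_gt0 : (0 < r)%N by apply: leq_trans hr.
have s_gt0 : (0 < s)%N by rewrite gcdn_gt0 n_gt0.
have HG : HS n r *m adj4 n r = 4%:M.
  rewrite -[LHS]/(_ * _); have := HS_adj4 n r.
  rewrite -signr_odd; case: (odd _) => [->|].
    by rewrite expr1 opprK -[4]/(1 *+ 4); apply/matrixP => p q; rewrite !mxE; ring.
  (* An even exponent would give H_S G = 0, hence G = 0 and C = 0 by regularity; but the diagonal
     entries of C are 1 modulo 2. *)
  rewrite expr0 subrr mul0rn => /(regular_mul_eq0 hreg)/adj4_eq0 C0.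
  have := map_diag_sum n_gt0 r_gt0; rewrite C0 (map_mx0 intr).
  pose p : 'I_(\sum_(i < n) r) := tagnat.Rank (Ordinal n_gt0) (Ordinal r_gt0).
  move/matrixP/(_ p p)/eqP; rewrite !mxE.
  under eq_bigr => i _ do rewrite !mxE.
  by rewrite (sum_delta_mod _ s_gt0) /= modn_mod eqxx eq_sym oner_eq0.
have := block_count_rank hreg hL HG; rewrite rank_adj4 // -/s.
(* Half of s - gcd(s, 2) is the floor of (s - 1)/2 for either parity of s. *)
have -> : gcdn s 2 = (~~ odd s).+1.
  case: (boolP (odd s)) => os; first by apply/eqP; move: os; rewrite -coprimen2.
  by apply/gcdn_idPr; rewrite dvdn2.
lia.
Qed.
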